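(* Let $G:\Omega\to\Omega$ and $F:\Lambda\to\Lambda$ be as in the context. Given a $G$-invariant Borel probability $\mu$ on $\Omega$, there exists an $F^{-1}$-invariant Borel probability $\bar\mu$ on $\Lambda$ such that $h_{\bar\mu}(F^{-1})\ge h_\mu(G)$.
   Context: Horseshoe. $I=[0,1]$, $R_0=I\times I\times[0,1/6]$, $R_1=I\times I\times[5/6,1]$; constants $0<\lambda_0<1/3$, $\beta_0>6$, $0<\sigma_0<1/3$, $3<\beta_1<4$; $f$ the time-one map of $y'=(1-y)y$, i.e. $f^n(y)=\frac{1}{1-(1-\frac1y)e^{-n}}$, $f(0)=0$; $F(x,y,z)=(\lambda_0x,f(y),\beta_0z)$ on $R_0$, $F(x,y,z)=(\tfrac34-\lambda_0x,\sigma_0(1-y),\beta_1(z-\tfrac56))$ on $R_1$; $\Lambda=\bigcap_{n\in\mathbb{Z}}F^n(R_0\cup R_1)$, $F:\Lambda\to\Lambda$ a homeomorphism. The map $G$: $S_1=[0,\lambda_0]\times[0,1]\times\{0\}$, $S_2=[\tfrac34-\lambda_0,\tfrac34]\times[0,\sigma_0]\times\{0\}$, $S_3=[0,\lambda_0]\times[0,1]\times\{5/6\}$, $g_0=f^{-1}$, $g_1(y)=1-\sigma_0^{-1}y$, $a=\lambda_0^{-1}$; $G(x,y,z)=(ax,g_0(y),0)$ on $S_1\cup S_3$, $G(x,y,z)=(a(\tfrac34-x),g_1(y),\tfrac56)$ on $S_2$; $\Omega=\bigcap_{n\in\mathbb{N}}G^{-n}(S_1\cup S_2\cup S_3)$,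 $G:\Omega\to\Omega$. The projection $\pi:R_0\cup R_1\to\mathbb{R}^3$, $\pi(x,y,z)=(x,y,0)$ on $R_0$ and $(x,y,5/6)$ on $R_1$, is continuous, maps $\Lambda$ onto $\Omega$ and satisfies $\pi\circ F^{-1}=G\circ\pi$. *)

(* Defs.v *)
From HB Require Import structures.
From mathcomp Require Import all_boot all_order all_algebra.
From mathcomp Require Import all_classical all_reals all_analysis.
Set Implicit Arguments. Unset Strict Implicit. Unset Printing Implicit Defensive.
Import Order.TTheory GRing.Theory Num.Theory.
Local Open Scope classical_set_scope.
Local Open Scope ring_scope.

Section Entropy.
Context {d : measure_display} {T : measurableType d} {R : realType}.

Definition is_meas_partition (k : nat) (P : 'I_k -> set T) : Prop :=
  (forall i, measurable (P i)) /\
  (forall i j, i != j -> P i `&` P j = set0) /\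
  (\bigcup_i P i = setT).

Definition eta_fun (t : R) : R := if t == 0 then 0 else - (t * ln t).

Definition join_cell (Tm : T -> T) (k n : nat) (P : 'I_k -> set T)
  (w : {ffun 'I_n -> 'I_k}) : set T :=
  \bigcap_(j in [set: 'I_n]) (iter j Tm @^-1` P (w j)).

Definition H_join (mu : probability T R) (Tm : T -> T) (k n : nat)
  (P : 'I_k -> set T) : R :=
  \sum_(w : {ffun 'I_n -> 'I_k}) eta_fun (fine (mu (join_cell Tm P w))).

(* h_mu(T, xi) = lim_n (1/n) H_mu(\/_{j<n} T^-j xi)  (taken as limsup; the limit exists) *)
Definition entropy_partition (mu : probability T R) (Tm : T -> T) (k : nat)
  (P : 'I_k -> set T) : \bar R :=
  limn_esup (fun n => ((H_join mu Tm n.+1 P) / n.+1%:R)%:E).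

Definition ks_entropy (mu : probability T R) (Tm : T -> T) : \bar R :=
  ereal_sup [set x | exists (k : nat) (P : 'I_k -> set T),
                       is_meas_partition P /\ x = entropy_partition mu Tm P].

Definition is_invariant (mu : probability T R) (Tm : T -> T) : Prop :=
  forall A, measurable A -> mu (Tm @^-1` A) = mu A.

End Entropy.

Section Horseshoe.
Context {R : realType}.
Variables (lam0 beta0 sigma0 beta1 : R).

Definition pt := (R * R * R)%type.
Definition px (p : pt) : R := p.1.1.
Definition py (p : pt) : R := p.1.2.
Definition pz (p : pt) : R := p.2.

(* time-one map f of y' = (1-y) y :  f(y) = 1/(1 - (1 - 1/y) e^{-1}), f(0) = 0 *)
Definition fmap (y : R) : R :=
  if y == 0 then 0 else (1 - (1 - y^-1) * expR (-1))^-1.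
(* g0 = f^{-1} :  f^{-1}(y) = 1/(1 - (1 - 1/y) e), f^{-1}(0) = 0 *)
Definition g0 (y : R) : R :=
  if y == 0 then 0 else (1 - (1 - y^-1) * expR 1)^-1.
Definition g1 (y : R) : R := 1 - sigma0^-1 * y.

Definition unitI (t : R) : Prop := 0 <= t <= 1.
Definition R0 : set pt :=
  [set p | unitI (px p) /\ unitI (py p) /\ 0 <= pz p <= 6^-1].
Definition R1 : set pt :=
  [set p | unitI (px p) /\ unitI (py p) /\ 5 / 6 <= pz p <= 1].

(* F on R0 u R1 (the formula for R1 is used off R0; values off R0 u R1 play no role) *)
Definition Fmap (p : pt) : pt :=
  if `[< R0 p >] then (lam0 * px p, fmap (py p), beta0 * pz p)
  else (3 / 4 - lam0 * px p, sigma0 * (1 - py p), beta1 * (pz p - 5 / 6)).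

(* Lambda = \bigcap_{n in Z} F^n(R0 u R1) *)
Definition Lambda : set pt :=
  [set p | forall n : nat,
     (forall k, (k <= n)%N -> (R0 `|` R1) (iter k Fmap p)) /\
     (exists q, (forall k, (k <= n)%N -> (R0 `|` R1) (iter k Fmap q)) /\
                iter n Fmap q = p)].

(* F^{-1}: the (unique) preimage in R0 u R1 *)
Definition Finv (p : pt) : pt := xget p [set q | (R0 `|` R1) q /\ Fmap q = p].

Definition S1 : set pt :=
  [set p | 0 <= px p <= lam0 /\ unitI (py p) /\ pz p = 0].
Definition S2 : set pt :=
  [set p | 3 / 4 - lam0 <= px p <= 3 / 4 /\ 0 <= py p <= sigma0 /\ pz p = 0].
Definition S3 : set pt :=
  [set p | 0 <= px p <= lam0 /\ unitI (py p) /\ pz p = 5 / 6].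

Definition acoef : R := lam0^-1.

(* G (formula for S1 u S3 used off S2; values off S1 u S2 u S3 play no role) *)
Definition Gmap (p : pt) : pt :=
  if `[< S2 p >] then (acoef * (3 / 4 - px p), g1 (py p), 5 / 6)
  else (acoef * px p, g0 (py p), 0).

Definition Omega : set pt :=
  [set p | forall n : nat, (S1 `|` S2 `|` S3) (iter n Gmap p)].

End Horseshoe.

(* Main.v *)
Require Import Defs.
From HB Require Import structures.
From mathcomp Require Import all_boot all_order all_algebra.
From mathcomp Require Import all_classical all_reals all_analysis.
From mathcomp Require Import measurable_realfun lra ring.
Set Implicit Arguments. Unset Strict Implicit. Unset Printing Implicit Defensive.
Import Order.TTheory GRing.Theory Num.Theory.
Import numFieldNormedType.Exports.
Local Open Scope classical_set_scope.
Local Open Scope ring_scope.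

(** Every point of [Omega] has at most two preimages under [G], and all of them
    lie in [Omega]: an upper point (height 5/6) has one, in [S2], and a floor
    point has two, one in [S1] and one in [S3]. A random backward orbit of a
    [mu]-distributed point is thus a Markov chain whose only randomness is the
    choice between [S1] and [S3], made with the conditional probability given
    by a Radon-Nikodym density [p]. One uniform variable [u] drives all the
    choices: compare [u] with [p], then rescale [u] to a fresh uniform variable.
    This gives a map [Theta] on [R^3 * R] that preserves [mu * uniform] and is a
    right inverse of [G] on the first factor.

    The symbols (floor or upper) along the [Theta]-orbit are the [F]-itinerary
    of a point of [Lambda]; its [z]-coordinate [Z] is the fixed point of the
    corresponding contractions. So [psi (w, u) = (x w, y w, Z (w, u))] satisfies
    [F o psi = psi o Theta], the image [nu] of [mu * uniform] under [psi] is
    invariant, and it projects to [mu]. Pulling a partition back along the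
    projection preserves the measure of all cells of its refinements, hence the
    entropy. *)

(** * Image measures, uniform variables and densities *)

Lemma probability_setI_full d (T : measurableType d) (R : realType)
    (P : probability T R) (W A : set T) :
  measurable W -> P W = 1%E -> measurable A -> P A = P (A `&` W).
Proof.
move=> mW W1 mA; rewrite -[in LHS](setUIDK A W) measureU.
- rewrite [X in (_ + X)%E](_ : _ = 0%E) ?adde0//.
  apply/eqP; rewrite eq_le measure_ge0 andbT.
  have <- : P (~` W) = 0%E by rewrite probability_setC// W1 subee.
  apply: le_measure; rewrite ?inE; last by move=> x [].
  - exact: measurableD.
  - exact: measurableC.
- exact: measurableI.
- exact: measurableD.
- by rewrite -subset0 => x [[_ Wx] [_]].
Qed.

Lemma measurable_preimage d d' (T : measurableType d) (T' : measurableType d')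
    (f : T -> T') (A : set T') :
  measurable_fun setT f -> measurable A -> measurable (f @^-1` A).
Proof. by move=> mf mA; rewrite -[_ @^-1` _]setTI; exact: mf. Qed.

(** The formula covers every set [A], measurable or not; this matters for [Lambda] and for preimages
    under [Finv], whose measurability is never established. *)
Lemma image_probability d d' (T : measurableType d) (T' : measurableType d')
    (R : realType) (P : probability T R) (f : T -> T') :
  measurable_fun setT f ->
  exists Q : probability T' R, forall A, Q A = P (f @^-1` A).
Proof.
move=> mf.
pose X : {mfun T >-> T'} := HB.pack f (@isMeasurableFun.Build _ _ _ _ f mf).
by exists (distribution P X).
Qed.

(** The pushforward scaled by [c^-1] gives half-open intervals their length, so uniqueness
    identifies it with Lebesgue measure. *)
Lemma lebesgue_measure_affine (R : realType) (q c : R) (B : set R) :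
  0 < c -> measurable B ->
  lebesgue_measure ((fun u : R => (u - q) / c) @^-1` B) =
  (c%:E * lebesgue_measure B)%E.
Proof.
move=> c0 mB.
have mf : measurable_fun [set: measurableTypeR R]
    ((fun u : R => (u - q) / c) : measurableTypeR R -> measurableTypeR R).
  have : measurable_fun [set: R] (fun u : R => (u - q) / c).
    by apply: measurable_funM => //; exact: measurable_funB.
  by [].
have ci0 : 0 <= c^-1 by rewrite invr_ge0 ltW.
pose m1 := pushforward (@lebesgue_measure R)
  ((fun u : R => (u - q) / c) : measurableTypeR R -> measurableTypeR R).
pose m2 : {measure set (measurableTypeR R) -> \bar R} := mscale (NngNum ci0) m1.
rewrite (_ : lebesgue_measure B = m2 mf B).
  by rewrite /m2 /= /mscale /= muleA -EFinM divff ?gt_eqF// mul1e.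
apply: lebesgue_measure_unique => // _ [[a b] _ <-].
rewrite /m2 /= /mscale /= /m1 /pushforward.
rewrite (_ : _ @^-1` _ = `]q + c * a, q + c * b]%classic); last first.
  apply/seteqP; split => u /=; rewrite !in_itv /= ltr_pdivlMr// ler_pdivrMr//;
  move=> /andP[]; lra.
rewrite !lebesgue_measure_itv /= !lte_fin ltrD2l ltr_pM2l//.
case: ifP => _; last by rewrite mule0.
by rewrite -!EFinB -EFinM; congr (_%:E); field; rewrite gt_eqF.
Qed.

(* Conditionally on [u < p] or on [p <= u], the rescaled variable is again
   uniform, so one uniform variable can drive infinitely many random choices. *)
Lemma uniform_self_similar (R : realType) : exists U : probability R R,
  forall (p : R) (B : set R), 0 <= p <= 1 -> measurable B ->
  U [set u | u < p /\ B (u / p)] = (p%:E * U B)%E /\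
  U [set u | p <= u /\ B ((u - p) / (1 - p))] = ((1 - p)%:E * U B)%E.
Proof.
(* The uniform law is put on the half-open [[0, 1[]: the pieces [[0, p[] and [[p, 1[] rescale
   exactly to it, and for [p = 0] or [p = 1] the degenerate piece is empty. *)
have [U UE] : exists U : probability R R, forall A,
    measurable A -> U A = lebesgue_measure (A `&` `[0, 1[).
  have mid : measurable_fun [set: measurableTypeR R] (idfun : _ -> R).
    exact: (@measurable_id _ R setT).
  have [U UE] := image_probability (uniform_prob (@ltr01 R)) mid.
  exists U => A mA; rewrite UE preimage_id.
  transitivity (\int[uniform_prob (@ltr01 R)]_x (\1_A x)%:E)%E.
    by rewrite integral_indic// setIT.
  have mind : measurable_fun [set: R] (fun x => (\1_A x)%:E : \bar R).
    by apply/measurable_EFinP; exact: measurable_indic.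
  rewrite integral_uniform//.
  rewrite subr0 invr1 mul1e -integral_itv_bndo_bndc//; last exact: measurable_funS mind.
  by rewrite integral_indic// setIC.
have mdiv (a b : R) : measurable_fun setT (fun u : R => (u - a) / b).
  by apply: measurable_funM => //; exact: measurable_funB.
exists U => p B /andP[p0 p1] mB.
have mB' : measurable (B `&` `[0, 1[) by exact: measurableI.
split.
- rewrite !UE//; last first.
    rewrite (_ : [set _ | _] = `]-oo, p[ `&` ((fun u : R => (u - 0) / p) @^-1` B)).
      by apply: measurableI => //; rewrite -[_ @^-1` _]setTI; exact: mdiv.
    by apply/seteqP; split => u /=; rewrite in_itv/= subr0.
  move: p0; rewrite le_eqVlt => /predU1P[<-|p0].
    rewrite mul0e (_ : _ `&` _ = set0) ?measure0// -subset0 => u /= [[u0 _]].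
    by rewrite in_itv/= leNgt u0.
  rewrite -(lebesgue_measure_affine 0)//; congr lebesgue_measure.
  apply/seteqP; split => u /=; rewrite subr0 !in_itv/= ler_pdivlMr// ltr_pdivrMr// mul0r mul1r.
    by move=> [[-> ?] /andP[-> _]].
  by move=> [? /andP[-> up]]; rewrite up (lt_le_trans up p1).
- rewrite !UE//; last first.
    rewrite (_ : [set _ | _] = `[p, +oo[ `&` ((fun u : R => (u - p) / (1 - p)) @^-1` B)).
      by apply: measurableI => //; rewrite -[_ @^-1` _]setTI; exact: mdiv.
    by apply/seteqP; split => u /=; rewrite in_itv/= andbT.
  move: p1; rewrite le_eqVlt => /predU1P[->|p1].
    rewrite subrr mul0e (_ : _ `&` _ = set0) ?measure0// -subset0 => u /= [[u0 _]].
    by rewrite in_itv/= ltNge u0 andbF.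
  have q0 : 0 < 1 - p by lra.
  rewrite -(lebesgue_measure_affine p)//; congr lebesgue_measure.
  apply/seteqP; split => u /=; rewrite !in_itv/= ler_pdivlMr// ltr_pdivrMr//
    mul0r mul1r ltrD2r subr_ge0.
    by move=> [[-> ?] /andP[_ ->]].
  by move=> [? /andP[pu ->]]; rewrite pu (le_trans p0 pu).
Qed.

(** For a [G]-invariant [mu], the density of [kappa] with respect to [mu] is the conditional
    probability of [E] given the value of [G]. *)
Lemma finite_image_restr d (T : measurableType d) (R : realType)
    (mu : probability T R) (G : T -> T) (E : set T) :
  measurable_fun setT G -> measurable E ->
  exists kappa : {finite_measure set T -> \bar R},
    forall A, kappa A = mu (G @^-1` A `&` E).
Proof.
move=> mG mE.
pose k0 := pushforward (mrestr mu mE) G.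
pose k1 : {measure set T -> \bar R} := k0.
have fk : fin_num_fun (k1 mG : set T -> \bar R).
  move=> A mA; rewrite /= /k0 /pushforward /mrestr.
  apply: fin_num_measure; apply: measurableI => //.
  by rewrite -[_ @^-1` _]setTI; exact: mG.
pose k2 : {finite_measure set T -> \bar R} :=
  HB.pack (k1 mG : set T -> \bar R) (Measure.on (k1 mG))
    (Measure_isFinite.Build _ _ _ (k1 mG) fk).
by exists k2.
Qed.

(** Domination yields a Radon-Nikodym density. On the set where it exceeds 1, the excess has
    integral at most 0, so this set is null and truncation at 1 changes no integral. The bounds hold
    at every point because [p x] later serves as a branching probability. *)
Lemma density_le1 d (T : measurableType d) (R : realType)
    (mu : probability T R) (kappa : {finite_measure set T -> \bar R}) :
  (forall A, measurable A -> (kappa A <= mu A)%E) ->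
  exists p : T -> R, [/\ measurable_fun setT p, (forall x, 0 <= p x <= 1) &
    forall A, measurable A -> kappa A = (\int[mu]_(x in A) (p x)%:E)%E].
Proof.
move=> kmu.
have dom : kappa `<< mu.
  apply/null_content_dominatesP => A mA muA0.
  by apply/eqP; rewrite eq_le measure_ge0 -muA0 kmu.
pose f := Radon_Nikodym_SigmaFinite.f kappa mu.
have f0 x : (0 <= f x)%E by exact: Radon_Nikodym_SigmaFinite.f_ge0.
have ff x : f x \is a fin_num by exact: Radon_Nikodym_SigmaFinite.f_fin_num.
have fint : mu.-integrable setT f by exact: Radon_Nikodym_SigmaFinite.f_integrable.
have fE A : measurable A -> kappa A = (\int[mu]_(x in A) f x)%E.
  by move=> mA; exact: Radon_Nikodym_SigmaFinite.f_integral.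
have mf : measurable_fun setT f by exact: measurable_int fint.
pose g x := fine (f x).
have mg : measurable_fun setT g.
  by apply: measurableT_comp => //; exact: measurable_fine.
have gf x : (g x)%:E = f x by rewrite fineK.
exists (fun x => Num.min (g x) 1); split.
- by apply: measurable_minr => //.
- by move=> x; rewrite le_min ge_min lexx orbT fine_ge0// ler01.
move=> A mA; rewrite fE//.
pose N := [set x | 1 < g x].
have mN : measurable N.
  rewrite (_ : N = setT `&` g @^-1` `]1, +oo[); first exact: mg.
  by rewrite setTI; apply/seteqP; split => x /=; rewrite in_itv/= andbT.
have muN : mu.-negligible N.
  have mh : measurable_fun N (fun x => (g x - 1)%:E).
    apply/measurable_EFinP; apply: measurable_funB => //.
    exact: measurable_funS mg.
  have /(ae_eq_integral_abs _ mN mh) : (\int[mu]_(x in N) `|(g x - 1)%:E| = 0)%E.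
    have -> : (\int[mu]_(x in N) `|(g x - 1)%:E| = \int[mu]_(x in N) (g x - 1)%:E)%E.
      apply: eq_integral => x /set_mem /= Nx.
      by rewrite ger0_norm// subr_ge0 ltW.
    apply/eqP; rewrite eq_le; apply/andP; split; last first.
      by apply: integral_ge0 => x /= Nx; rewrite lee_fin subr_ge0 ltW.
    have H1 : (\int[mu]_(x in N) f x = \int[mu]_(x in N) (g x - 1)%:E + mu N)%E.
      rewrite (_ : mu N = \int[mu]_(x in N) (1%:E))%E; last first.
        by rewrite integral_cst// mul1e.
      rewrite -ge0_integralD//.
      - by apply: eq_integral => x _; rewrite -EFinD subrK gf.
      - by move=> x /= Nx; rewrite lee_fin subr_ge0 ltW.
    have := kmu _ mN; rewrite fE// H1 -{2}[mu N]add0e leeD2rE//.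
    exact: fin_num_measure.
  move=> [M [mM muM subM]]; exists M; split => // x Nx; apply: subM => /= /(_ Nx) /eqP.
  by rewrite eqe subr_eq0 => /eqP e; move: Nx; rewrite /N /= e ltxx.
apply: ae_eq_integral => //.
- exact: measurable_funS mf.
- apply/measurable_EFinP; apply: (@measurable_funS _ _ _ _ setT) => //.
  exact: measurable_minr.
- move: muN => [M [mM muM subM]]; exists M; split => // x /= xA.
  apply: subM; apply: contrapT => Nx; apply: xA => _.
  by rewrite min_l ?gf// leNgt; exact/negP.
Qed.

Lemma measurable_invr (R : realType) : measurable_fun setT (@GRing.inv R).
Proof.
rewrite -(setUv [set 0]); apply/measurable_funU => //; first exact: measurableC.
split; first exact: measurable_fun_set1.
apply: open_continuous_measurable_fun.
  by rewrite openC; exact: closed_eq.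
move=> x /set_mem /= /eqP x0; exact: inv_continuous.
Qed.

(** * Random backward orbits and the natural extension *)

Lemma product_measure_fiberwise d (T : measurableType d) (R : realType)
    (mu : probability T R) (U : probability R R) (Y : set (T * R)) (D : set T)
    (q : T -> R) (c : \bar R) :
  measurable D -> measurable_fun setT q -> (forall w, 0 <= q w) -> (0 <= c)%E ->
  (forall w, D w -> U (xsection Y w) = ((q w)%:E * c)%E) ->
  (forall w, ~ D w -> xsection Y w = set0) ->
  (mu \x U)%E Y = (c * \int[mu]_(w in D) (q w)%:E)%E.
Proof.
move=> mD mq q0 c0 YD YC.
have mqE : measurable_fun D (fun w => (q w)%:E).
  by apply/measurable_EFinP; exact: measurable_funS mq.
rewrite -ge0_integralZl//; last by move=> w _; rewrite lee_fin.
rewrite integral_mkcond; apply: eq_integral => w _ /=; rewrite patchE.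
case: ifPn => [/set_mem|/negP] wD; first by rewrite YD// muleC.
by rewrite YC ?measure0// => Dw; apply: wD; rewrite inE.
Qed.

(** For a uniform second coordinate, [b1] is taken with probability [p v.1] and the rescaled
    remainder is again uniform. Where [p v.1] is 0 or 1, division by zero occurs only in the branch
    of probability zero. *)
Definition random_branch (T : Type) (R : realType) (b0 b1 : T -> T) (p : T -> R)
    (v : T * R) : T * R :=
  if v.2 < p v.1 then (b1 v.1, v.2 / p v.1)
  else (b0 v.1, (v.2 - p v.1) / (1 - p v.1)).

Lemma measurable_random_branch d (T : measurableType d) (R : realType)
    (b0 b1 : T -> T) (p : T -> R) :
  measurable_fun setT b0 -> measurable_fun setT b1 -> measurable_fun setT p ->
  measurable_fun setT (random_branch b0 b1 p).
Proof.
move=> mb0 mb1 mp.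
have m2 : measurable_fun setT (fun v : T * R => v.2) by exact: measurable_snd.
have mp1 : measurable_fun setT (fun v : T * R => p v.1).
  by apply: measurableT_comp => //; exact: measurable_fst.
apply: measurable_fun_ifT; first exact: measurable_fun_ltr.
- apply: measurable_fun_pair.
    by apply: measurableT_comp => //; exact: measurable_fst.
  apply: measurable_funM => //; apply: measurableT_comp => //.
  exact: measurable_invr.
- apply: measurable_fun_pair.
    by apply: measurableT_comp => //; exact: measurable_fst.
  apply: measurable_funM; first exact: measurable_funB.
  apply: (measurableT_comp (@measurable_invr R)).
  exact: measurable_funB.
Qed.

(* The natural extension of [G], realised on [T * R]: the backward orbit of a
   point [w] is a Markov chain that picks the branch [b1] with the conditional
   probability of [E] given [G = w], and [Theta] is its shift. *)
Lemma natural_extension d (T : measurableType d) (R : realType)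
    (mu : probability T R) (G b0 b1 : T -> T) (E W : set T) :
  measurable_fun setT G -> measurable_fun setT b0 -> measurable_fun setT b1 ->
  measurable E -> measurable W -> mu W = 1%E -> is_invariant mu G ->
  (forall w, W w -> E w -> b1 (G w) = w) ->
  (forall w, W w -> ~ E w -> b0 (G w) = w) ->
  exists (P : probability (T * R)%type R) (Theta : T * R -> T * R),
    [/\ measurable_fun setT Theta, is_invariant P Theta,
        (forall A, measurable A -> P (A `*` setT) = mu A) &
        forall v, (Theta v).1 = b0 v.1 \/ (Theta v).1 = b1 v.1].
Proof.
move=> mG mb0 mb1 mE mW W1 Ginv b1G b0G.
have muW A : measurable A -> mu A = mu (A `&` W) by exact: probability_setI_full.
have mpre := @measurable_preimage _ _ T T.
have [kappa kE] := finite_image_restr mu mG mE.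
have kmu A : measurable A -> (kappa A <= mu A)%E.
  move=> mA; rewrite kE -(Ginv _ mA); apply: le_measure; rewrite ?inE//.
  - by apply: measurableI => //; exact: mpre.
  - exact: mpre.
have [p [mp p01 pE]] := density_le1 kmu.
have [U US] := uniform_self_similar R.
have Hb1 A : measurable A -> (\int[mu]_(w in b1 @^-1` A) (p w)%:E)%E = mu (A `&` E).
  move=> mA; rewrite -pE; last exact: mpre.
  rewrite kE [LHS]muW; last first.
    by apply: measurableI => //; exact: mpre (mpre _ _ _ _).
  rewrite [RHS]muW; last exact: measurableI.
  congr (mu _); apply/seteqP; split => w /= [[Aw Ew] Ww]; split => //; split => //.
    by rewrite /= b1G in Aw.
  by rewrite b1G.
have Hb0 A : measurable A ->
    (\int[mu]_(w in b0 @^-1` A) (1 - p w)%:E)%E = mu (A `\` E).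
  move=> mA; set C := b0 @^-1` A; have mC : measurable C by exact: mpre.
  have mpC : measurable_fun C (fun w => (p w)%:E).
    by apply/measurable_EFinP; exact: measurable_funS mp.
  have kC : (mu C = \int[mu]_(w in C) (1 - p w)%:E + kappa C)%E.
    rewrite pE// -ge0_integralD//.
    - rewrite -[LHS]mul1e -integral_cst//.
      by apply: eq_integral => w _; rewrite -EFinD subrK.
    - by move=> w _; rewrite lee_fin subr_ge0; case/andP: (p01 w).
    - apply/measurable_EFinP; apply: measurable_funB => //.
      exact: measurable_funS mp.
    - by move=> w _; rewrite lee_fin; case/andP: (p01 w).
  have {}kC : (\int[mu]_(w in C) (1 - p w)%:E = mu C - kappa C)%E.
    by rewrite kC addeK//; exact: fin_num_measure.
  have mGC : measurable (G @^-1` C) by exact: mpre.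
  rewrite kC kE -(Ginv _ mC) -[X in (mu X - _)%E](setUIDK (G @^-1` C) E) measureU//.
  - rewrite addeAC subee ?add0e; last first.
      by apply: fin_num_measure; exact: measurableI.
    rewrite [LHS]muW; last exact: measurableD.
    rewrite [RHS]muW; last exact: measurableD.
    congr (mu _); apply/seteqP; split => w /= [[Aw Ew] Ww]; split => //; split => //.
      by rewrite /C /= b0G in Aw.
    by rewrite /C /= b0G.
  - exact: measurableI.
  - exact: measurableD.
  - by rewrite -subset0 => x [[_ ?] [_]].
exists (mu \x U)%E, (random_branch b0 b1 p).
have mTh := measurable_random_branch mb0 mb1 mp.
split => //.
(* By uniqueness of the product measure it suffices to test rectangles. The preimage of a rectangle
   splits into [Y1], where [b1] is used, and [Y0], where [b0] is used. *)
- pose m' := pushforward (mu \x U)%E (random_branch b0 b1 p).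
  pose m1 : {measure set (T * R) -> \bar R} := m'.
  move=> X mX; symmetry; apply: (@product_measure_unique _ _ _ _ _ mu U (m1 mTh)) => // A B mA mB.
  rewrite /= /m' /pushforward.
  set Y1 := [set v : T * R | v.2 < p v.1 /\ (A (b1 v.1) /\ B (v.2 / p v.1))].
  set Y0 := [set v : T * R | p v.1 <= v.2 /\
    (A (b0 v.1) /\ B ((v.2 - p v.1) / (1 - p v.1)))].
  have -> : random_branch b0 b1 p @^-1` (A `*` B) = Y1 `|` Y0.
    apply/seteqP; split => -[w u]; rewrite /random_branch /Y1 /Y0 /=.
      by case: ltP => /= ? []; [left|right].
    by case=> -[]; case: ltP.
  have mlt : measurable [set v : T * R | v.2 < p v.1].
    have : measurable_fun setT (fun v : T * R => v.2 < p v.1).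
      apply: measurable_fun_ltr; first exact: measurable_snd.
      by apply: measurableT_comp => //; exact: measurable_fst.
    move=> /(_ measurableT [set true]); rewrite setTI; apply => //.
  have mTAB : measurable (random_branch b0 b1 p @^-1` (A `*` B)).
    by rewrite -[_ @^-1` _]setTI; apply: mTh => //; exact: measurableX.
  have mY1 : measurable Y1.
    rewrite (_ : Y1 = [set v : T * R | v.2 < p v.1] `&` random_branch b0 b1 p @^-1` (A `*` B)).
      exact: measurableI.
    apply/seteqP; split => -[w u]; rewrite /random_branch /Y1 /=; case: ltP => ? [] //= ? [] //.
  have mY0 : measurable Y0.
    rewrite (_ : Y0 = random_branch b0 b1 p @^-1` (A `*` B) `\` [set v : T * R | v.2 < p v.1]).
      exact: measurableD.
    apply/seteqP; split => -[w u]; rewrite /random_branch /Y0 /=; case: ltP => ? [] //= ? [] //.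
  have e1 : (mu \x U)%E Y1 = (U B * mu (A `&` E))%E.
    rewrite -Hb1//; apply: product_measure_fiberwise => //.
    - exact: mpre.
    - by move=> w; case/andP: (p01 w).
    - move=> w /= Aw; rewrite -(US (p w) B (p01 w) mB).1; congr (U _).
      by apply/seteqP; split => u; rewrite /xsection/= inE /Y1/=; tauto.
    - by move=> w nA; rewrite -subset0 => u; rewrite /xsection/= inE /Y1/= => -[_ []].
  have e0 : (mu \x U)%E Y0 = (U B * mu (A `\` E))%E.
    rewrite -Hb0//; apply: product_measure_fiberwise => //.
    - exact: mpre.
    - exact: measurable_funB.
    - by move=> w; rewrite subr_ge0; case/andP: (p01 w).
    - move=> w /= Aw; rewrite -(US (p w) B (p01 w) mB).2; congr (U _).
      by apply/seteqP; split => u; rewrite /xsection/= inE /Y0/=; tauto.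
    - by move=> w nA; rewrite -subset0 => u; rewrite /xsection/= inE /Y0/= => -[_ []].
  transitivity (U B * mu (A `&` E) + U B * mu (A `\` E))%E.
    rewrite -e1 -e0; apply: measureU => //.
    by rewrite -subset0 => v [[+ _] [+ _]] => /lt_geF ->.
  rewrite -ge0_muleDr ?measure_ge0// muleC; congr (_ * _)%E.
  rewrite -measureU//; [by rewrite setUIDK|exact: measurableI|exact: measurableD|].
  by rewrite -subset0 => x [[_ ?] [_]].
- move=> A mA; transitivity (mu A * U setT)%E; last by rewrite probability_setT mule1.
  exact: product_measure1E.
- by move=> v; rewrite /random_branch; case: ifP; [right|left].
Qed.

(** * The time-one map of the logistic flow and its inverse *)

(** In the coordinate [1 - y^-1] this is multiplication by [c]. The values [expR (-1)] and [expR 1]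
    of [c] give [fmap] and [g0]. *)
Definition logistic (R : realType) (c y : R) : R :=
  if y == 0 then 0 else (1 - (1 - y^-1) * c)^-1.

(** For [0 < y <= 1] the denominator is at least 1, since [y^-1 >= 1]. *)
Lemma logistic_unit (R : realType) (c y : R) :
  0 < c -> unitI y -> unitI (logistic c y).
Proof.
move=> c0 /andP[y0 y1]; rewrite /unitI /logistic; case: eqP => [_|/eqP yn0].
  by rewrite lexx ler01.
have yp : 0 < y by rewrite lt_neqAle eq_sym yn0.
have D1 : 1 <= 1 - (1 - y^-1) * c.
  have : 0 <= (y^-1 - 1) * c.
    by rewrite mulr_ge0 ?subr_ge0 ?invf_ge1// ltW.
  lra.
by rewrite invr_ge0 invf_le1 ?(le_trans ler01 D1)//= (lt_le_trans ltr01 D1).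
Qed.

Lemma logisticK (R : realType) (c c' y : R) :
  0 < c -> c * c' = 1 -> unitI y -> logistic c' (logistic c y) = y.
Proof.
move=> c0 cc' /andP[y0 y1]; rewrite [logistic c y]/logistic.
case: eqP => [->|/eqP yn0]; first by rewrite /logistic eqxx.
have yp : 0 < y by rewrite lt_neqAle eq_sym yn0.
have D1 : 1 <= 1 - (1 - y^-1) * c.
  have : 0 <= (y^-1 - 1) * c.
    by rewrite mulr_ge0 ?subr_ge0 ?invf_ge1// ltW.
  lra.
rewrite /logistic invr_eq0 gt_eqF ?(lt_le_trans ltr01 D1)// invrK.
rewrite -[RHS]invrK; congr (_^-1).
rewrite (_ : 1 - (1 - (1 - y^-1) * c) = (1 - y^-1) * c); last by ring.
by rewrite -mulrA cc'; ring.
Qed.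

Lemma measurable_logistic (R : realType) (c : R) :
  measurable_fun setT (logistic c).
Proof.
apply: measurable_fun_ifT => //; first exact: measurable_fun_eqr.
apply: (measurableT_comp (@measurable_invr R)); apply: measurable_funB => //.
apply: measurable_funM => //; apply: measurable_funB => //.
exact: measurable_invr.
Qed.

Lemma expR1N1 (R : realType) : expR 1 * expR (-1) = 1 :> R.
Proof. by rewrite -expRD subrr expR0. Qed.


Lemma fmap_unit (R : realType) (y : R) : unitI y -> unitI (Defs.fmap y).
Proof. exact/logistic_unit/expR_gt0. Qed.

Lemma fmapK (R : realType) (y : R) : unitI y -> g0 (Defs.fmap y) = y.
Proof. by apply: logisticK; rewrite ?expR_gt0// mulrC expR1N1. Qed.

Lemma g0K (R : realType) (y : R) : unitI y -> Defs.fmap (g0 y) = y.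
Proof. by apply: logisticK; rewrite ?expR_gt0// expR1N1. Qed.

(** * Borel measurability of [G] and of its invariant set *)

Section measurability.
Context {R : realType}.

Lemma measurable_px : measurable_fun setT (@px R).
Proof. exact: (measurableT_comp measurable_fst measurable_fst). Qed.

Lemma measurable_py : measurable_fun setT (@py R).
Proof. exact: (measurableT_comp measurable_snd measurable_fst). Qed.

Lemma measurable_pz : measurable_fun setT (@pz R).
Proof. exact: measurable_snd. Qed.

Lemma measurable_box (a b c d e f : R) :
  measurable [set p : pt | a <= px p <= b /\ c <= py p <= d /\ e <= pz p <= f].
Proof.
rewrite (_ : [set p | _] = (px @^-1` `[a, b]) `&` ((py @^-1` `[c, d]) `&` (pz @^-1` `[e, f]))).
  apply: measurableI; last apply: measurableI.
  - by rewrite -[_ @^-1` _]setTI; exact: measurable_px.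
  - by rewrite -[_ @^-1` _]setTI; exact: measurable_py.
  - by rewrite -[_ @^-1` _]setTI; exact: measurable_pz.
by apply/seteqP; split => p /=; rewrite !in_itv/=.
Qed.

Lemma measurable_S1 (lam0 : R) : measurable (S1 lam0).
Proof.
rewrite (_ : S1 lam0 = [set p | 0 <= px p <= lam0 /\ 0 <= py p <= 1 /\ 0 <= pz p <= 0]).
  exact: measurable_box.
apply/seteqP; split => p /= [? [? Hz]]; do ![split => //].
  by rewrite Hz lexx.
by apply/eqP; rewrite eq_le andbC.
Qed.

Lemma measurable_S2 (lam0 sigma0 : R) : measurable (S2 lam0 sigma0).
Proof.
rewrite (_ : S2 lam0 sigma0 = [set p | 3 / 4 - lam0 <= px p <= 3 / 4 /\
    0 <= py p <= sigma0 /\ 0 <= pz p <= 0]).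
  exact: measurable_box.
apply/seteqP; split => p /= [? [? Hz]]; do ![split => //].
  by rewrite Hz lexx.
by apply/eqP; rewrite eq_le andbC.
Qed.

Lemma measurable_S3 (lam0 : R) : measurable (S3 lam0).
Proof.
rewrite (_ : S3 lam0 = [set p | 0 <= px p <= lam0 /\ 0 <= py p <= 1 /\ 5 / 6 <= pz p <= 5 / 6]).
  exact: measurable_box.
apply/seteqP; split => p /= [? [? Hz]]; do ![split => //].
  by rewrite Hz lexx.
by apply/eqP; rewrite eq_le andbC.
Qed.

Lemma measurable_asbool d (T : measurableType d) (A : set T) :
  measurable A -> measurable_fun setT (fun x => `[< A x >]).
Proof.
move=> mA; apply: (@measurable_fun_bool _ _ _ _ true).
rewrite setTI (_ : _ @^-1` _ = A)//.
by apply/seteqP; split => x /=; [move/asboolP|move=> ?; apply/asboolP].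
Qed.

Lemma measurable_pt3 d (T : measurableType d) (f g h : T -> R) :
  measurable_fun setT f -> measurable_fun setT g -> measurable_fun setT h ->
  measurable_fun setT (fun x => (f x, g x, h x)).
Proof. by move=> *; do 2![apply: measurable_fun_pair => //]. Qed.

Lemma measurable_Gmap (lam0 sigma0 : R) : measurable_fun setT (Gmap lam0 sigma0).
Proof.
apply: measurable_fun_ifT; first by apply: measurable_asbool; exact: measurable_S2.
- apply: measurable_pt3 => //.
    apply: measurable_funM => //; apply: measurable_funB => //.
    exact: measurable_px.
  apply: measurable_funB => //; apply: measurable_funM => //.
  exact: measurable_py.
- apply: measurable_pt3 => //.
    by apply: measurable_funM => //; exact: measurable_px.
  exact: (measurableT_comp (measurable_logistic _) measurable_py).
Qed.

Lemma measurable_iter d (T : measurableType d) (f : T -> T) n :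
  measurable_fun setT f -> measurable_fun setT (iter n f).
Proof.
move=> mf; elim: n => [|n IH]; first exact: measurable_id.
exact: (measurableT_comp mf IH).
Qed.

Lemma measurable_Omega (lam0 sigma0 : R) : measurable (Omega lam0 sigma0).
Proof.
rewrite (_ : Omega _ _ = \bigcap_n
    (iter n (Gmap lam0 sigma0) @^-1` (S1 lam0 `|` S2 lam0 sigma0 `|` S3 lam0))).
  apply: bigcapT_measurable => n; rewrite -[_ @^-1` _]setTI.
  apply: (measurable_iter n (measurable_Gmap _ _)) => //.
  apply: measurableU; last exact: measurable_S3.
  by apply: measurableU; [exact: measurable_S1|exact: measurable_S2].
by apply/seteqP; split => p /=; [move=> H n _; exact: H|move=> H n; exact: (H n)].
Qed.

End measurability.

(** * Inverse branches of [G] *)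

Section horseshoe.
Context {R : realType}.
Variables (lam0 beta0 sigma0 beta1 : R).
Hypotheses (hlam0 : 0 < lam0 < 3^-1) (hbeta0 : 6 < beta0).
Hypotheses (hsigma0 : 0 < sigma0 < 3^-1) (hbeta1 : 3 < beta1 < 4).

Local Notation G := (Gmap lam0 sigma0).
Local Notation F := (Fmap lam0 beta0 sigma0 beta1).
Local Notation Finv := (Finv lam0 beta0 sigma0 beta1).
Local Notation Omega := (Omega lam0 sigma0).
Local Notation Sall := (S1 lam0 `|` S2 lam0 sigma0 `|` S3 lam0).
Implicit Types (w : @pt R) (z e : R).

(** Both heights are allowed: these are the two unit squares on which every branch is a right
    inverse of [G]. *)
Definition floor_pt w : Prop := [/\ unitI (px w), unitI (py w) & pz w = 0 \/ pz w = 5 / 6].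

Definition upper w : bool := pz w == 5 / 6.

(* [branch 0] inverts [G] on [S1] and [S2], [branch (5 / 6)] on [S3] and [S2]. *)
Definition branch e w : @pt R :=
  if upper w then (3 / 4 - lam0 * px w, sigma0 * (1 - py w), 0)
  else (lam0 * px w, Defs.fmap (py w), e).

Lemma lam0_gt0 : 0 < lam0. Proof. by case/andP: hlam0. Qed.
Lemma sigma0_gt0 : 0 < sigma0. Proof. by case/andP: hsigma0. Qed.
Lemma beta0_gt0 : 0 < beta0. Proof. by rewrite (lt_trans _ hbeta0). Qed.
Lemma beta1_gt0 : 0 < beta1. Proof. by case/andP: hbeta1 => [+ _]; exact: lt_trans. Qed.

Lemma scale_unit (c x : R) : 0 < c -> unitI x -> 0 <= c * x <= c.
Proof. by move=> c0 /andP[x0 x1]; rewrite mulr_ge0 ?ler_piMr// ltW. Qed.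

Lemma Gmap_S2 w : S2 lam0 sigma0 w ->
  G w = (lam0^-1 * (3 / 4 - px w), 1 - sigma0^-1 * py w, 5 / 6).
Proof. by move=> S2w; rewrite /Gmap asboolT. Qed.

(** As [lam0 < 3^-1], the strip [px w <= lam0] lies strictly to the left of [S2]. *)
Lemma Gmap_S13 w : px w <= lam0 -> G w = (lam0^-1 * px w, g0 (py w), 0).
Proof.
move=> wl; rewrite /Gmap asboolF// => -[/andP[wu _] _].
by move: hlam0 => /andP[]; lra.
Qed.

Lemma Sall_floor w : Sall w -> floor_pt w.
Proof.
move: hlam0 hsigma0 => /andP[l0 l1] /andP[s0 s1].
move=> [[|]|] [/andP[x0 x1] [/andP[y0 y1] z0]]; split; rewrite /unitI; lra.
Qed.

Lemma branch_Sall e w : e = 0 \/ e = 5 / 6 -> floor_pt w -> Sall (branch e w).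
Proof.
move=> he [ux uy _]; rewrite /branch; case: ifP => _.
  left; right; rewrite /S2 /px /py /pz /=.
  have /andP[? ?] := scale_unit lam0_gt0 ux.
  have : unitI (1 - py w) by move: uy; rewrite /unitI; lra.
  by move=> /(scale_unit sigma0_gt0) ?; split => //; lra.
have lx := scale_unit lam0_gt0 ux; have fy := fmap_unit uy.
by case: he => ->; [left; left|right].
Qed.

(** [G] writes height 5/6 on [S2] and 0 on [S1] and [S3], so the branch selected by [upper w] leads
    back to the height of [w] as well. *)
Lemma branchK e w : e = 0 \/ e = 5 / 6 -> floor_pt w -> G (branch e w) = w.
Proof.
move=> he wf; have Sb := branch_Sall he wf; case: wf => ux uy hz.
have lx := scale_unit lam0_gt0 ux.
move: Sb; rewrite /branch /upper; case: eqP => zw Sb.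
  rewrite Gmap_S2; last first.
    case: Sb => [[[/= hx _]|//]|[/= hx _]]; rewrite /px /= in hx lx;
    by move: hlam0 hx lx => /andP[? ?] /andP[? ?] /andP[? ?]; lra.
  rewrite /px /py /= [3 / 4 - _]subKr mulKf ?gt_eqF ?lam0_gt0//.
  rewrite mulKf ?gt_eqF ?sigma0_gt0// subKr -zw.
  by case: w {ux uy lx Sb hz} zw => -[].
rewrite Gmap_S13; last by case/andP: lx.
rewrite /px /py /= mulKf ?gt_eqF ?lam0_gt0// fmapK//.
by case: hz => // <-; case: w {ux uy lx Sb zw} => -[].
Qed.

(** The image of [S3] is at height 0, and the parameter 5/6 restores the height that [G] forgets. *)
Lemma branch_upper w : S3 lam0 w -> branch (5 / 6) (G w) = w.
Proof.
move=> [/andP[x0 x1] [uy zw]]; rewrite Gmap_S13// /branch /upper /px /py /pz /=.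
rewrite ifF; last by apply/negbTE/eqP; lra.
rewrite mulVKf ?gt_eqF ?lam0_gt0// g0K// -zw.
by case: w {x0 x1 uy zw} => -[].
Qed.

Lemma branch_lower w : (S1 lam0 `|` S2 lam0 sigma0) w -> branch 0 (G w) = w.
Proof.
case=> -[/andP[x0 x1] [uy zw]].
  rewrite Gmap_S13// /branch /upper /px /py /pz /=.
  rewrite ifF; last by apply/negbTE/eqP; lra.
  rewrite mulVKf ?gt_eqF ?lam0_gt0// g0K// -zw.
  by case: w {x0 x1 uy zw} => -[].
rewrite Gmap_S2; last by split => //; rewrite x0.
rewrite /branch /upper /px /py /pz /= eqxx mulVKf ?gt_eqF ?lam0_gt0// !subKr.
rewrite mulVKf ?gt_eqF ?sigma0_gt0// -zw.
by case: w {x0 x1 uy zw} => -[].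
Qed.

Lemma Omega_Sall w : Omega w -> Sall w. Proof. by move=> /(_ 0%N). Qed.

Lemma Omega_Gmap w : Omega w -> Omega (G w).
Proof. by move=> Ow n; rewrite -iterSr; exact: Ow. Qed.

Lemma Omega_branch e w : e = 0 \/ e = 5 / 6 -> Omega w -> Omega (branch e w).
Proof.
move=> he Ow; have wf := Sall_floor (Omega_Sall Ow).
by case=> [|n]; [exact: branch_Sall|rewrite iterSr branchK//; exact: Ow].
Qed.

Lemma measurable_upper : measurable_fun setT upper.
Proof. by apply: measurable_fun_eqr => //; exact: measurable_pz. Qed.

Lemma measurable_branch e : measurable_fun setT (branch e).
Proof.
apply: measurable_fun_ifT; first exact: measurable_upper.
- apply: measurable_pt3 => //.
    apply: measurable_funB => //; apply: measurable_funM => //.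
    exact: measurable_px.
  apply: measurable_funM => //; apply: measurable_funB => //.
  exact: measurable_py.
- apply: measurable_pt3 => //.
    by apply: measurable_funM => //; exact: measurable_px.
  exact: (measurableT_comp (measurable_logistic _) measurable_py).
Qed.

(** * Injectivity of [F], and lifts of [G]-orbits to backward [F]-orbits *)

Lemma Fmap_R0 (p : @pt R) : R0 p ->
  F p = (lam0 * px p, Defs.fmap (py p), beta0 * pz p).
Proof. by move=> R0p; rewrite /Fmap asboolT. Qed.

Lemma Fmap_R1 (p : @pt R) : R1 p ->
  F p = (3 / 4 - lam0 * px p, sigma0 * (1 - py p), beta1 * (pz p - 5 / 6)).
Proof.
move=> [_ [_ /andP[z5 _]]]; rewrite /Fmap asboolF// => -[_ [_ /andP[_ z6]]]; lra.
Qed.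

(** The images of [R0] and [R1] have disjoint [x]-ranges, [[0, lam0]] and [[3 / 4 - lam0, 3 / 4]];
    within one block each coordinate map is injective. This makes the choice in [Finv] unique. *)
Lemma Fmap_inj (p q : @pt R) :
  (R0 `|` R1) p -> (R0 `|` R1) q -> F p = F q -> p = q.
Proof.
move: p q => [[x y] z] [[x' y'] z'].
have nz := (gt_eqF lam0_gt0, gt_eqF sigma0_gt0, gt_eqF beta0_gt0, gt_eqF beta1_gt0).
have lx t : unitI t -> 0 <= lam0 * t <= lam0 by exact: scale_unit lam0_gt0.
case/andP: hlam0 => l0 l1.
case=> [Rp|Rp] [Rq|Rq]; rewrite ?(Fmap_R0 Rp) ?(Fmap_R1 Rp) ?(Fmap_R0 Rq) ?(Fmap_R1 Rq);
  case: Rp => [ux [uy _]]; case: Rq => [ux' [uy' _]];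
  rewrite /px /py /pz /= in ux ux' uy uy' *; move=> -[ex ey ez].
- move: ex ez => /(mulfI (negbT nz.1.1.1)) -> /(mulfI (negbT nz.1.2)) ->.
  by rewrite -(fmapK uy) ey fmapK.
- by move: ex (lx _ ux) (lx _ ux') => ? /andP[? ?] /andP[? ?]; exfalso; lra.
- by move: ex (lx _ ux) (lx _ ux') => ? /andP[? ?] /andP[? ?]; exfalso; lra.
- have {}ex : lam0 * x = lam0 * x' by lra.
  move: ex ez ey => /(mulfI (negbT nz.1.1.1)) -> /(mulfI (negbT nz.2)) ez.
  move=> /(mulfI (negbT nz.1.1.2)) ey.
  by congr (_, _, _); lra.
Qed.

Lemma FmapK (p : @pt R) : (R0 `|` R1) p -> Finv (F p) = p.
Proof.
move=> Rp; apply: xget_subset1 => // q q' [Rq eq] [Rq' eq'].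
by apply: Fmap_inj => //; rewrite eq.
Qed.

Definition lift w z : @pt R := (px w, py w, z).

Definition fits w z : Prop :=
  if upper w then 5 / 6 <= z <= 1 else 0 <= z <= 6^-1.

(** Inverses of the expanding [z]-components of [F], on [R1] for [true] and on [R0] for [false]. *)
Definition contract (b : bool) z : R :=
  if b then 5 / 6 + z / beta1 else z / beta0.

Lemma lift_R0 w z : Omega w -> upper w = false -> fits w z -> R0 (lift w z).
Proof. by move=> /Omega_Sall/Sall_floor[ux uy _] uw; rewrite /fits uw. Qed.

Lemma lift_R1 w z : Omega w -> upper w = true -> fits w z -> R1 (lift w z).
Proof. by move=> /Omega_Sall/Sall_floor[ux uy _] uw; rewrite /fits uw. Qed.

Lemma lift_R w z : Omega w -> fits w z -> (R0 `|` R1) (lift w z).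
Proof.
move=> Ow; have [uw|uw] := boolP (upper w) => zw.
  by right; exact: lift_R1.
by left; apply: lift_R0 => //; exact/negbTE.
Qed.

(** One backward step of [F] in lifted coordinates: [G] acts on the base, and the height of [G w]
    tells which block contains the preimage. *)
Lemma contractK w z : Omega w -> fits w z ->
  fits (G w) (contract (upper (G w)) z) /\
  F (lift (G w) (contract (upper (G w)) z)) = lift w z.
Proof.
move=> Ow zw; have OG := Omega_Gmap Ow.
have nl : lam0 != 0 by rewrite gt_eqF ?lam0_gt0.
have ns : sigma0 != 0 by rewrite gt_eqF ?sigma0_gt0.
have z01 : 0 <= z <= 1.
  by move: zw; rewrite /fits; case: ifP => _ /andP[? ?]; apply/andP; split; lra.
have fG : fits (G w) (contract (upper (G w)) z).
  rewrite /fits /contract; case uG : (upper (G w)).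
    (* An upper image arises only from [S2], at height 0, so [z] is at most 1/6. The bound [z <= 1]
       alone would let [5 / 6 + z / beta1] exceed 1, as [beta1 < 4]. *)
    have z6 : 0 <= z <= 6^-1.
      case: (Omega_Sall Ow) => [[|]|]; last 1 first.
      - move=> [/andP[_ wl] _]; move: uG; rewrite Gmap_S13// /upper /pz /= => /eqP ?; exfalso; lra.
      - move=> [/andP[_ wl] _]; move: uG; rewrite Gmap_S13// /upper /pz /= => /eqP ?; exfalso; lra.
      - move=> [_ [_ z0]]; move: zw; rewrite /fits /upper z0 ifF//.
        by apply/negbTE/eqP; lra.
    case/andP: z6 => z0 z6; have b0 := beta1_gt0.
    have : 0 <= z / beta1 by rewrite divr_ge0// ltW.
    have : z / beta1 <= 6^-1.
      by rewrite ler_pdivrMr//; case/andP: hbeta1 => ? ?; lra.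
    by move: (z / beta1) => t t6 t0; apply/andP; split; lra.
  case/andP: z01 => z0 z1; have b0 := beta0_gt0.
  by rewrite divr_ge0 ?(ltW b0)//= ler_pdivrMr//; move: hbeta0 => ?; lra.
split => //.
have lower : px w <= lam0 -> unitI (py w) ->
    F (lift (G w) (contract (upper (G w)) z)) = lift w z.
  move=> wl uy; have uG : upper (G w) = false.
    by rewrite Gmap_S13// /upper; apply/negbTE/eqP; rewrite /pz /=; lra.
  rewrite Fmap_R0; last exact: lift_R0.
  rewrite uG Gmap_S13// /lift /px /py /pz /=; congr (_, _, _).
  - by rewrite mulVKf.
  - by rewrite g0K.
  - by rewrite mulrC divfK// gt_eqF ?beta0_gt0.
case: (Omega_Sall Ow) => [[|S2w]|].
- by move=> [/andP[_ wl] [uy _]]; exact: lower.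
- have uG : upper (G w) = true by rewrite Gmap_S2// /upper /pz /= eqxx.
  rewrite Fmap_R1; last exact: lift_R1.
  rewrite uG Gmap_S2// /lift /px /py /pz /=; congr (_, _, _).
  - by rewrite mulVKf// subKr.
  - by rewrite subKr mulVKf.
  - by rewrite addrC addKr mulrC divfK// gt_eqF ?beta1_gt0.
- by move=> [/andP[_ wl] [uy _]]; exact: lower.
Qed.

Lemma Finv_lift w z : Omega w -> fits w z ->
  Finv (lift w z) = lift (G w) (contract (upper (G w)) z).
Proof.
move=> Ow zw; have [fG {1}<-] := contractK Ow zw.
exact/FmapK/lift_R/fG/Omega_Gmap.
Qed.

Lemma iter_Finv_lift n w z : Omega w -> fits w z ->
  exists2 z', fits (iter n G w) z' & iter n Finv (lift w z) = lift (iter n G w) z'.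
Proof.
move=> Ow zw; elim: n => [|n [z' fz' e]]; first by exists z.
have On : Omega (iter n G w) by elim: (n) => //= m; exact: Omega_Gmap.
exists (contract (upper (G (iter n G w))) z'); first by have [] := contractK On fz'.
by rewrite !iterS e Finv_lift.
Qed.

(** Applying [G] to the base goes one step back under [F], so a backward orbit of a lift of [G w]
    extends to one of [lift w z]. *)
Lemma lift_backward n w z : Omega w -> fits w z ->
  exists2 q, forall k, (k <= n)%N -> (R0 `|` R1) (iter k F q) & iter n F q = lift w z.
Proof.
elim: n w z => [|n IH] w z Ow zw.
  by exists (lift w z) => // k; rewrite leqn0 => /eqP ->; exact: lift_R.
have [fG FG] := contractK Ow zw.
have [q Rq qE] := IH _ _ (Omega_Gmap Ow) fG.
have qE1 : iter n.+1 F q = lift w z by rewrite iterS qE.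
exists q => // k; rewrite leq_eqVlt ltnS => /predU1P[->|]; last exact: Rq.
by rewrite qE1; exact: lift_R.
Qed.

Lemma R0_origin : R0 ((0, 0, 0) : @pt R).
Proof. by do !split; rewrite /unitI /px /py /pz /= lexx ?ler01 ?invr_ge0 ?ler0n. Qed.

Lemma Fmap_origin : F (0, 0, 0) = (0, 0, 0).
Proof.
rewrite (Fmap_R0 R0_origin).
by rewrite /px /py /pz /= !mulr0 /Defs.fmap eqxx.
Qed.

Lemma Lambda_origin : Lambda lam0 beta0 sigma0 beta1 (0, 0, 0).
Proof.
have R00 : (R0 `|` R1) ((0, 0, 0) : @pt R) by left; exact: R0_origin.
have F0 k : iter k F (0, 0, 0) = (0, 0, 0).
  by elim: k => //= k ->; exact: Fmap_origin.
move=> n; split=> [k _|]; first by rewrite F0.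
by exists (0, 0, 0); split => [k _|]; rewrite F0.
Qed.

Lemma Finv_origin : Finv (0, 0, 0) = (0, 0, 0).
Proof.
rewrite -{1}Fmap_origin; apply: FmapK; left; exact: R0_origin.
Qed.

(** The projection of the two blocks onto heights 0 and 5/6, extended to a measurable map of the
    whole space; the threshold 1/2 separates [z <= 1/6] from [z >= 5/6]. *)
Definition flatten_pt (p : @pt R) : @pt R :=
  (px p, py p, if pz p <= 2^-1 then 0 else 5 / 6).

Lemma flatten_lift w z : Omega w -> fits w z -> flatten_pt (lift w z) = w.
Proof.
move=> /Omega_Sall/Sall_floor[_ _]; rewrite /fits /upper /flatten_pt /lift /px /py /pz /=.
case: w => [[x y] t] /=; case: eqP => [-> _ /andP[z5 _]|t0 [->|//] /andP[_ z6]].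
  by rewrite ifF//; apply/negbTE; rewrite -ltNge; lra.
by rewrite ifT//; lra.
Qed.

Lemma measurable_flatten_pt : measurable_fun setT flatten_pt.
Proof.
apply: measurable_pt3; [exact: measurable_px|exact: measurable_py|].
apply: measurable_fun_ifT => //; apply: measurable_fun_ler => //.
exact: measurable_pz.
Qed.

(** * The height coordinate as a limit of contractions *)

Lemma contract_le b z z' : z <= z' -> contract b z <= contract b z'.
Proof.
move=> zz'; rewrite /contract; case: b; last by rewrite ler_pM2r ?invr_gt0 ?beta0_gt0.
by rewrite lerD2l ler_pM2r ?invr_gt0 ?beta1_gt0.
Qed.

Lemma contract_bounds b z M : 0 <= z <= M ->
  if b then 5 / 6 <= contract b z <= 5 / 6 + M / 3 else 0 <= contract b z <= M / 6.
Proof.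
move=> /andP[z0 zM]; have M0 := le_trans z0 zM; rewrite /contract; case: b.
  rewrite lerDl divr_ge0 ?(ltW beta1_gt0)//= lerD2l ler_pM// ?invr_ge0 ?(ltW beta1_gt0)//.
  by rewrite lef_pV2 ?posrE ?beta1_gt0//; case/andP: hbeta1 => [/ltW].
rewrite divr_ge0 ?(ltW beta0_gt0)//= ler_pM// ?invr_ge0 ?(ltW beta0_gt0)//.
by rewrite lef_pV2 ?posrE ?beta0_gt0// ltW.
Qed.

(** Iterating the contractions from height 0 gives a sequence that increases, by monotonicity of
    [contract], and is bounded by 5/4, the fixed point of [M = 5 / 6 + M / 3]. Its pointwise limit
    is therefore measurable and solves the equation. *)
Lemma height_exists d (V : measurableType d) (Theta : V -> V) (s : V -> bool) :
  measurable_fun setT Theta -> measurable_fun setT s ->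
  exists Z : V -> R, [/\ measurable_fun setT Z,
    (forall v, Z v = contract (s v) (Z (Theta v))) & forall v, 0 <= Z v <= 5 / 4].
Proof.
move=> mTh ms.
pose Zn := fix Zn (n : nat) (v : V) : R :=
  if n is m.+1 then contract (s v) (Zn m (Theta v)) else 0.
have Zn_bnd n v : 0 <= Zn n v <= 5 / 4.
  elim: n v => [|n IH] v /=; first by rewrite lexx divr_ge0.
  have := contract_bounds (s v) (IH (Theta v)).
  by case: (s v) => /andP[? ?]; apply/andP; split; lra.
have Zn_nd v : nondecreasing_seq (Zn ^~ v).
  apply/nondecreasing_seqP => n; elim: n v => [|n IH] v.
    by have /andP[] := Zn_bnd 1%N v.
  exact/contract_le/IH.
have Zn_cvg v : Zn ^~ v @ \oo --> limn (Zn ^~ v).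
  apply: nondecreasing_is_cvgn => //.
  by exists (5 / 4) => _ [n _ <-]; have /andP[] := Zn_bnd n v.
have mZn n : measurable_fun setT (Zn n).
  elim: n => [|n IH] /=; first exact: measurable_cst.
  have mZT : measurable_fun setT (fun v => Zn n (Theta v)).
    exact: (measurableT_comp IH mTh).
  apply: measurable_fun_ifT => //.
    by apply: measurable_funD => //; apply: measurable_funM.
  exact: measurable_funM.
exists (fun v => limn (Zn ^~ v)); split.
- by apply: (@measurable_fun_cvg _ _ _ _ Zn) => // v _; exact: Zn_cvg.
(* The shifted sequence at [v] is [contract] applied to the sequence at [Theta v]; continuity passes
   this to the limit. *)
- move=> v; apply/cvg_lim => //; rewrite -cvg_shiftS /=.
  rewrite /contract; case: (s v).
    by apply: cvgD; [exact: cvg_cst|apply: cvgMl; exact: Zn_cvg].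
  by apply: cvgMl; exact: Zn_cvg.
- move=> v; apply/andP; split.
    apply: limr_ge; first exact: Zn_cvg.
    by apply: nearW => n; have /andP[] := Zn_bnd n v.
  apply: limr_le; first exact: Zn_cvg.
  by apply: nearW => n; have /andP[] := Zn_bnd n v.
Qed.

(** A bootstrap from the bound 5/4: floor heights are at most 5/24. Both branches send an upper
    point to the floor, so upper heights are at most 5/6 + 5/72 < 1. With the bound 1 everywhere,
    one more contraction gives the sharp intervals. *)
Lemma fits_height (Theta : @pt R * R -> @pt R * R) (Z : @pt R * R -> R) :
  (forall v, (Theta v).1 = branch 0 v.1 \/ (Theta v).1 = branch (5 / 6) v.1) ->
  (forall v, Z v = contract (upper v.1) (Z (Theta v))) ->
  (forall v, 0 <= Z v <= 5 / 4) ->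
  forall v, fits v.1 (Z v).
Proof.
move=> Thb ZE Zb.
have Zlow v : upper v.1 = false -> 0 <= Z v <= (5 / 4) / 6.
  by move=> uv; have := contract_bounds (upper v.1) (Zb (Theta v)); rewrite -ZE uv.
have Z1 v : 0 <= Z v <= 1.
  have [uv|/negbTE uv] := boolP (upper v.1); last first.
    by have /andP[? ?] := Zlow _ uv; apply/andP; split; lra.
  have uT : upper (Theta v).1 = false.
    have /eqP n0 : (0 : R) != 5 / 6 by apply/eqP; lra.
    by case: (Thb v) => ->; rewrite /branch uv /upper /pz /=; apply/eqP.
  have := contract_bounds (upper v.1) (Zlow _ uT); rewrite -ZE uv => /andP[? ?].
  by apply/andP; split; lra.
move=> v; rewrite /fits; case uv : (upper v.1).
  have /andP[_ ->] := Z1 v; rewrite andbT.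
  by have := contract_bounds (upper v.1) (Z1 (Theta v)); rewrite -ZE uv => /andP[].
by have := contract_bounds (upper v.1) (Z1 (Theta v)); rewrite -ZE uv div1r.
Qed.

End horseshoe.

(** * The lifted measure and its entropy *)

Theorem theorem5p1 (R : realType) (lam0 beta0 sigma0 beta1 : R)
  (hlam0 : 0 < lam0 < 3^-1) (hbeta0 : 6 < beta0)
  (hsigma0 : 0 < sigma0 < 3^-1) (hbeta1 : 3 < beta1 < 4)
  (mu : probability (R * R * R)%type R)
  (mu_Omega : mu (Omega lam0 sigma0) = 1%E)
  (mu_inv : is_invariant mu (Gmap lam0 sigma0)) :
  exists nu : probability (R * R * R)%type R,
    nu (Lambda lam0 beta0 sigma0 beta1) = 1%E /\
    is_invariant nu (Finv lam0 beta0 sigma0 beta1) /\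
    (ks_entropy mu (Gmap lam0 sigma0) <= ks_entropy nu (Finv lam0 beta0 sigma0 beta1))%E.
Proof.
set F := Fmap lam0 beta0 sigma0 beta1; set Fi := Finv lam0 beta0 sigma0 beta1.
set G := Gmap lam0 sigma0; set Om := Omega lam0 sigma0.
have mG : measurable_fun setT G := measurable_Gmap lam0 sigma0.
have mO : measurable Om := measurable_Omega lam0 sigma0.
have mE : measurable [set w : @pt R | upper w].
  rewrite (_ : [set w | _] = setT `&` upper @^-1` [set true]); last by rewrite setTI.
  exact: measurable_upper.
have b1G w : Om w -> upper w -> branch lam0 sigma0 (5 / 6) (G w) = w.
  move=> Ow /eqP zw; apply: branch_upper => //.
  by case: (Omega_Sall Ow) => [[|]|//] [_ [_ z0]]; exfalso; lra.
have b0G w : Om w -> ~ upper w -> branch lam0 sigma0 0 (G w) = w.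
  move=> Ow zw; apply: branch_lower => //.
  by case: (Omega_Sall Ow) => // -[_ [_ z0]]; case: zw; rewrite /upper z0 eqxx.
have [P [Th [mTh Pinv PmU Thb]]] := natural_extension mG
  (measurable_branch lam0 sigma0 0) (measurable_branch lam0 sigma0 (5 / 6))
  mE mO mu_Omega mu_inv b1G b0G.
have [Z [mZ ZE Zb]] := height_exists hbeta0 hbeta1 mTh
  (measurableT_comp measurable_upper measurable_fst).
have Zf := fits_height hbeta0 hbeta1 Thb ZE Zb.
have ThO v : Om v.1 -> Om (Th v).1.
  by move=> Ov; case: (Thb v) => ->; apply: Omega_branch => //; [left|right].
have GTh v : Om v.1 -> G (Th v).1 = v.1.
  move=> Ov; have wf := Sall_floor hlam0 hsigma0 (Omega_Sall Ov).
  by case: (Thb v) => ->; apply: branchK => //; [left|right].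
(* Off [Omega], [psi] takes the value of a fixed point of [F], so that its whole
   range lies in [Lambda] and [nu Lambda = 1] needs no measurability of [Lambda]. *)
pose psi (v : @pt R * R) : @pt R := if `[< Om v.1 >] then lift v.1 (Z v) else (0, 0, 0).
have psiT v : Om v.1 -> psi v = lift v.1 (Z v) by move=> Ov; rewrite /psi asboolT.
have psiF v : ~ Om v.1 -> psi v = (0, 0, 0) by move=> Ov; rewrite /psi asboolF.
have mO1 : measurable_fun setT (fun v : @pt R * R => `[< Om v.1 >]).
  exact: (measurableT_comp (measurable_asbool mO) measurable_fst).
have mpsi : measurable_fun setT psi.
  apply: measurable_fun_ifT => //; apply: measurable_pt3 => //.
    exact: (measurableT_comp measurable_px measurable_fst).
  exact: (measurableT_comp measurable_py measurable_fst).
(* This is [contractK] at [(Th v).1], whose [G]-image is [v.1], combined with the fixed-point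
   equation for [Z]. *)
have FpsiE v : Om v.1 -> F (psi v) = psi (Th v).
  move=> Ov; have OT := ThO _ Ov; rewrite !psiT//.
  have [_] := contractK hlam0 hbeta0 hsigma0 hbeta1 OT (Zf (Th v)).
  by rewrite -/G GTh// -ZE.
have Rpsi v : (R0 `|` R1) (psi v).
  have [Ov|Ov] := pselect (Om v.1); last by rewrite psiF//; left; exact: R0_origin.
  by rewrite psiT//; exact: (lift_R hlam0 hsigma0 Ov).
have FipsiE v : Om v.1 -> Fi (psi (Th v)) = psi v.
  by move=> Ov; rewrite -FpsiE//; exact: FmapK.
(* [Fi] is defined by choice, so measurability is proved only for its composite with [psi], through
   an explicit formula. *)
have mFipsi : measurable_fun setT (Fi \o psi).
  rewrite (_ : Fi \o psi = fun v => if `[< Om v.1 >] then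
      lift (G v.1) (contract beta0 beta1 (upper (G v.1)) (Z v)) else (0, 0, 0)).
    have mG1 : measurable_fun setT (fun v : @pt R * R => G v.1).
      exact: (measurableT_comp mG measurable_fst).
    apply: measurable_fun_ifT => //; apply: measurable_pt3 => //.
    - exact: (measurableT_comp measurable_px mG1).
    - exact: (measurableT_comp measurable_py mG1).
    - apply: measurable_fun_ifT.
      + exact: (measurableT_comp measurable_upper mG1).
      + by apply: measurable_funD => //; apply: measurable_funM.
      + exact: measurable_funM.
  apply/funext => v /=; case: asboolP => Ov.
    by rewrite psiT//; exact: Finv_lift.
  by rewrite psiF//; exact: Finv_origin.
have mOT (A : set (@pt R)) : measurable A -> measurable (A `*` [set: R]).
  by move=> mA; exact: measurableX.
have POm X : measurable X -> P X = P (X `&` (Om `*` setT)).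
  by apply: probability_setI_full; [exact: mOT|rewrite PmU].
(* [Om] times the line has full measure, so two events need to agree only over [Om]. *)
have Pext X Y : measurable X -> measurable Y ->
    (forall v, Om v.1 -> X v <-> Y v) -> P X = P Y.
  move=> mX mY XY; rewrite (POm X)// (POm Y)//; congr (P _).
  by apply/seteqP; split => v [Xv [Ov _]]; split => //; apply/XY.
have mpre := @measurable_preimage _ _ (@pt R * R)%type (@pt R).
have [nu nuE] := image_probability P mpsi.
exists nu; split; last split.
- rewrite nuE (_ : _ @^-1` _ = setT) ?probability_setT//.
  apply/seteqP; split => // v _ /=.
  have [Ov|Ov] := pselect (Om v.1); last by rewrite psiF//; exact: Lambda_origin.
  have iterE k : Om (iter k Th v).1 /\ iter k F (psi v) = psi (iter k Th v).
    elim: k => //= k [Ok ->]; split; [exact: ThO|exact: FpsiE].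
  move=> n; split => [k _|].
    by have [_ ->] := iterE k.
  have [q Rq qE] := lift_backward hlam0 hbeta0 hsigma0 hbeta1 n Ov (Zf v).
  by exists q; split => //; rewrite qE psiT.
(* Inserting the [P]-preserving map [Th] turns [Fi \o psi] into [Fi \o psi \o Th], which is [psi]
   over [Om]. *)
- move=> A mA; rewrite !nuE -comp_preimage -Pinv; last exact: mpre.
  apply: Pext; first by rewrite -[_ @^-1` _]setTI; apply: mTh => //; exact: mpre.
    exact: mpre.
  by move=> v Ov /=; rewrite FipsiE.
- apply: le_ereal_sup => _ [k [Q [[mQ [dQ cQ]] ->]]].
  exists k, (fun i => flatten_pt @^-1` Q i); split.
    split; [|split].
    + by move=> i; rewrite -[_ @^-1` _]setTI; exact: measurable_flatten_pt.
    + by move=> i j ij; rewrite -preimage_setI dQ.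
    + by rewrite -preimage_bigcup cQ.
  rewrite /entropy_partition; congr limn_esup; apply/funext => n.
  congr (_ / _)%:E; rewrite /H_join; apply: eq_bigr => w _; congr (eta_fun (fine _)).
  set C := join_cell _ _ _; set C' := join_cell _ _ _.
  have mC : measurable C.
    apply: fin_bigcap_measurable => // j _.
    by rewrite -[_ @^-1` _]setTI; apply: measurable_iter.
  (* Over [Om], [flatten_pt] carries the [Fi]-orbit of [psi v] to the [G]-orbit of [v.1], so both
     cells prescribe the same itinerary. *)
  have CC' v : Om v.1 -> C' (psi v) <-> C v.1.
    move=> Ov; rewrite psiT//.
    have e j : flatten_pt (iter j Fi (lift v.1 (Z v))) = iter j G v.1.
      have [z' fz' ->] := iter_Finv_lift hlam0 hbeta0 hsigma0 hbeta1 j Ov (Zf v).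
      apply: (flatten_lift hlam0 hsigma0) => //.
      by elim: j {fz'} => //= j; exact: Omega_Gmap.
    by split => H j _; have := H j I; rewrite /= e.
  rewrite -PmU// nuE; apply: Pext; first exact: mOT.
    (* [C'] involves iterates of [Fi], so its preimage is computed explicitly: it is [C] over [Om],
       and all or nothing off [Om], where [psi] is constant. *)
    have -> : psi @^-1` C' = (C `&` Om) `*` setT `|` (if `[< C' (0, 0, 0) >]
        then ~` Om `*` setT else set0).
      apply/seteqP; split => v /=.
        have [Ov|Ov] := pselect (Om v.1).
          by move=> /(CC' _ Ov) ?; left.
        by rewrite psiF// => C0; right; rewrite asboolT.
      case=> [[[Cv Ov] _]|]; first exact/CC'.
      by case: asboolP => // C0 [Ov _]; rewrite psiF.
    apply: measurableU; first by apply: mOT; exact: measurableI.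
    by case: ifP => _ //; apply: mOT; exact: measurableC.
  by move=> v Ov /=; rewrite (CC' v Ov); tauto.
Qed.
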